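(* Let $d\ge1$ be an integer. Then there exists $c_d>0$ such that, for all integers $n,m\ge d+1$ satisfying $n+m\ge\binom{d+2}{2}$, $$a_d(K_{n,m})\ge c_d\cdot\min\{n,m\}.$$
   Context: $K_{n,m}$ is the complete bipartite graph with sides of size $n$ and $m$. For a finite simple graph $G=(V,E)$ with $|V|\ge d+1$ and $p:V\to\mathbb{R}^d$, for $u,v\in V$ put $d_{uv}=\frac{p(u)-p(v)}{\|p(u)-p(v)\|}$ if $p(u)\neq p(v)$ and $d_{uv}=0$ otherwise. The rigidity matrix $R(G,p)\in\mathbb{R}^{d|V|\times|E|}$ has rows indexed by pairs $(u,i)$, $u\in V$, $1\le i\le d$, columns indexed by edges, and entries $R(G,p)_{(u,i),e}=(d_{uv})_i$ if $e=\{u,v\}$ for some $v\in V$, and $0$ if $u\notin e$. The stiffness matrix is $L(G,p)=R(G,p)R(G,p)^{\top}$. Let $\lambda_k(M)$ denote the $k$-th smallest eigenvalue (with multiplicity) of a symmetric matrix $M$. The $d$-dimensional algebraic connectivity of $G$ is $$a_d(G)=\sup\left\{\lambda_{\binom{d+1}{2}+1}(L(G,p))\ :\ p:V\to\mathbb{R}^d\right\}.$$ *)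

(* Defs.v *)
From mathcomp Require Import all_boot all_order all_algebra.
From mathcomp Require Import boolp classical_sets reals.

Set Implicit Arguments.
Unset Strict Implicit.
Unset Printing Implicit Defensive.

Import Order.TTheory GRing.Theory Num.Theory.
Local Open Scope ring_scope.

Record sgraph (V : finType) := SGraph {
  adj :> rel V;
  adj_sym : symmetric adj;
  adj_irrefl : irreflexive adj }.

Definition edges (V : finType) (G : sgraph V) : {set {set V}} :=
  [set [set uv.1; uv.2] | uv : V * V & G uv.1 uv.2].

Definition complete_bipartite_adj (n m : nat) : rel ('I_n + 'I_m) :=
  fun x y => match x, y with
             | inl _, inr _ | inr _, inl _ => true
             | _, _ => false
             end.

Lemma complete_bipartite_sym n m : symmetric (@complete_bipartite_adj n m).
Proof. by move=> [x|x] [y|y]. Qed.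

Lemma complete_bipartite_irrefl n m :
  irreflexive (@complete_bipartite_adj n m).
Proof. by move=> [x|x]. Qed.

Definition complete_bipartite (n m : nat) : sgraph ('I_n + 'I_m)%type :=
  SGraph (@complete_bipartite_sym n m) (@complete_bipartite_irrefl n m).

(* The library norm `|x| on row vectors is the sup norm, not this one. *)
Definition euclidean_norm (R : realType) (d : nat) (x : 'rV[R]_d) : R :=
  Num.sqrt (\sum_(i < d) x 0 i ^+ 2).

Definition direction (R : realType) (d : nat) (V : finType)
    (p : V -> 'rV[R]_d) (u v : V) : 'rV[R]_d :=
  if p u == p v then 0 else (euclidean_norm (p u - p v))^-1 *: (p u - p v).

(* Rows are indexed by V * 'I_d and columns by edges G, both through
   enum_val.  As an edge has two distinct ends, the vertex v below is unique
   when u is an end of the edge, and there is none otherwise. *)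
Definition rigidity_mx (R : realType) (d : nat) (V : finType) (G : sgraph V)
    (p : V -> 'rV[R]_d) : 'M[R]_(#|{: V * 'I_d}|, #|edges G|) :=
  \matrix_(r, c)
    let: (u, i) := enum_val r in
    if [pick v | enum_val c == [set u; v]] is Some v
    then direction p u v 0 i else 0.

Definition stiffness_mx (R : realType) (d : nat) (V : finType) (G : sgraph V)
    (p : V -> 'rV[R]_d) : 'M[R]_#|{: V * 'I_d}| :=
  rigidity_mx G p *m (rigidity_mx G p)^T.

(* The eigenvalues with multiplicity, in nondecreasing order; the list is
   unique when it exists, and it exists for every symmetric M. *)
Definition spectrum (R : realType) (N : nat) (M : 'M[R]_N) : seq R :=
  xget [::] [set s : seq R | sorted <=%R s /\
    char_poly M = \prod_(x <- s) ('X - x%:P)]%classic.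

(* Counted from k = 1. *)
Definition kth_eigenvalue (R : realType) (N : nat) (k : nat) (M : 'M[R]_N) : R :=
  nth 0 (spectrum M) k.-1.

(* The eigenvalue index is in range when #|V| >= d.+1 and d >= 1; the set is
   then bounded above, since 2 * #|edges G| bounds the trace. *)
Definition algebraic_connectivity (R : realType) (d : nat) (V : finType)
    (G : sgraph V) : R :=
  sup (range (fun p : V -> 'rV[R]_d =>
    kth_eigenvalue ('C(d.+1, 2)).+1 (stiffness_mx G p))).

(* Main.v *)
Require Import Defs.
From mathcomp Require Import all_boot all_order all_algebra.
From mathcomp Require Import boolp classical_sets reals.
From mathcomp Require Import complex.
From mathcomp Require Import zify ring lra.

(** The quadratic form of the stiffness matrix sends a field of velocities
    [x] to the sum over the edges [uv] of [<d_uv, x_u - x_v> ^ 2].  By the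
    Courant-Fischer principle ([kth_eigenvalue_ge]) it is enough to find one
    placement [p] and a subspace of codimension at most [C(d+1, 2)] on which
    this form is at least [c * min(n, m) * |x|^2].

    Large complete bipartite graphs are reduced to finitely many small ones
    by blowing up.  Put [N = C(d+2, 2)], [a = min(n, N)], [b = min(m, N)],
    choose a placement of [K_{a,b}], and let [K_{n,m}] use the same points,
    each taken by about [n / a], respectively [m / b], vertices.  On each pair
    of fibers the form splits into a term in the mean velocities and two
    terms in the deviations from the mean ([sum_sqr_sub_mean]).  The mean
    part is the form of [K_{a,b}] with weights of order [n m]; the
    deviations at a point of one side see all the points of the other side,
    hence get a factor of order [m] or [n].  Since the means carry weight at
    most [max(n, m)] in [|x|^2], everything is at least of order [min(n, m)],
    provided that [K_{a,b}] is infinitesimally rigid at the chosen placement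
    and that the directions at each of its vertices span the space.

    The rigidity of [K_{a,b}] is a theorem of Bolker and Roth
    ([bipartite_infinitesimal_rigidity]).  In homogeneous coordinates
    [Q_i = (1, q_i)], [S_j = (1, r_j)], with [Z_i = (- <q_i, z_i>, z_i)] and
    [W_j = (- <r_j, w_j>, w_j)], a field [(z, w)] is an infinitesimal flex
    if and only if [<Q_i, W_j> = - <S_j, Z_i>] for all [i], [j].  When the
    points of each side span, this forces [W_j = M S_j] and [Z_i = - M^T Q_i]
    for a single square matrix [M] of size [d+1].  As [<Q_i, Z_i>] and
    [<S_j, W_j>] vanish, the quadratic form of [M] vanishes at all points; if
    they lie on no common quadric, [M] is skew.  Thus the flexes have
    dimension [C(d+1, 2)], and they are killed by as many linear conditions
    on [w], which read off the entries of [M] below the diagonal.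

    Points in the required position are found on a monomial curve,
    [p_j = (y_1 ^ j, ..., y_d ^ j)] for [j < a + b].  With [y_0 = 1], a
    quadratic form vanishing at these points is a linear relation between the
    sequences [j |-> (y_k y_l) ^ j].  The choice [y_k = 2 ^ (3 ^ k - 1)]
    makes the products [y_k y_l] pairwise distinct, and a Vandermonde
    argument ([power_sums_eq0]) then applies to any [C(d+2, 2)]
    consecutive exponents. *)

Set Implicit Arguments.
Unset Strict Implicit.
Unset Printing Implicit Defensive.

Import Order.TTheory GRing.Theory Num.Theory.
Local Open Scope ring_scope.

(** * Symmetric matrices and the Courant-Fischer bound *)

Lemma sum_sqr_le_card (R : realDomainType) (I : finType) (a : I -> R) :
  (\sum_i a i) ^+ 2 <= #|I|%:R * \sum_i a i ^+ 2.
Proof.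
have: 0 <= \sum_i \sum_j (a i - a j) ^+ 2.
  by do 2!apply: sumr_ge0 => ? _; exact: sqr_ge0.
have -> : \sum_i \sum_j (a i - a j) ^+ 2 =
    (#|I|%:R * \sum_i a i ^+ 2 - (\sum_i a i) ^+ 2) *+ 2.
  have -> : \sum_i \sum_j (a i - a j) ^+ 2 =
      \sum_i (a i ^+ 2 *+ #|I| - a i * (\sum_j a j) *+ 2 + \sum_j a j ^+ 2).
    apply: eq_bigr => i _; rewrite mulr_sumr -sumr_const -sumrMnl -sumrB -big_split.
    by apply: eq_bigr => j _ /=; rewrite sqrrB.
  rewrite big_split sumrB /= sumr_const !sumrMnl -mulr_suml.
  by rewrite mulr_natl; ring.
by rewrite pmulrn_lge0 // subr_ge0.
Qed.

Lemma sum_sqr_mulmx_le (R : realDomainType) (p q : nat) (A : 'M[R]_(p, q))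
    (B : R) (z : 'rV_p) :
    (forall i j, `|A i j| <= B) ->
  \sum_j (z *m A) 0 j ^+ 2 <= (q * p)%:R * B ^+ 2 * \sum_i z 0 i ^+ 2.
Proof.
move=> AB; have -> : (q * p)%:R * B ^+ 2 * \sum_i z 0 i ^+ 2 =
    \sum_(j < q) (p%:R * B ^+ 2 * \sum_i z 0 i ^+ 2).
  by rewrite sumr_const card_ord -[RHS]mulr_natl natrM !mulrA.
apply: ler_sum => j _; rewrite mxE.
apply: le_trans (sum_sqr_le_card _) _; rewrite card_ord -mulrA ler_wpM2l //.
rewrite mulr_sumr; apply: ler_sum => i _.
rewrite exprMn mulrC ler_wpM2r ?sqr_ge0 //.
by rewrite -[_ ^+ 2]real_normK ?num_real // lerXn2r ?nnegrE // (le_trans _ (AB i j)).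
Qed.

Local Notation toC M := (map_mx (real_complex _) M).
Local Open Scope sesquilinear_scope.

Lemma char_poly_similar (F : fieldType) (N : nat) (P A : 'M[F]_N) :
  P \in unitmx -> char_poly (invmx P *m A *m P) = char_poly A.
Proof.
move=> Pu; rewrite /char_poly.
have -> : char_poly_mx (invmx P *m A *m P) =
    map_mx polyC (invmx P) *m char_poly_mx A *m map_mx polyC P.
  rewrite /char_poly_mx mulmxBr mulmxBl -!map_mxM mul_mx_scalar -scalemxAl.
  by rewrite -map_mxM mulVmx // map_mx1 scalemx1.
rewrite !det_mulmx mulrAC -det_mulmx -map_mxM mulVmx //.
by rewrite map_mx1 det1 mul1r.
Qed.

(** Over the complex numbers [L] is hermitian, so it is diagonalized by a
    unitary matrix, with real eigenvalues.  The eigenvectors are left complex: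
    a bound for a real quadratic form passes to complex vectors through real
    and imaginary parts. *)
Lemma symmetric_spectral (R : rcfType) (N : nat) (L : 'M[R]_N) :
  L^T = L -> exists (P : 'M[R[i]]_N) (e : 'rV[R]_N),
    [/\ P *m P ^t* = 1%:M, toC L = P ^t* *m diag_mx (toC e) *m P &
        char_poly L = \prod_i ('X - (e 0 i)%:P)].
Proof.
move=> symL.
have hermL : toC L \is hermsymmx.
  apply: realsym_hermsym.
    apply/is_hermitianmxP; rewrite expr0 scale1r; apply/matrixP => i j.
    by rewrite -[in LHS]symL !mxE.
  apply/mxOverP => i j; rewrite mxE; by apply/complex_realP; eexists.
have /orthomx_spectralP := hermitian_normalmx hermL.
have /mxOverP realD := hermitian_spectral_diag_real hermL.
set P := spectralmx _; set D := spectral_diag _ => LE.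
have Pu : P \is unitarymx by exact: spectral_unitarymx.
have DE : D = toC (map_mx (@complex.Re R) D).
  by apply/rowP => i; rewrite !mxE RRe_real // realD.
have PP := unitarymxP Pu.
exists P, (map_mx (@complex.Re R) D); rewrite -DE; split => //.
  by rewrite {1}LE invmx_unitary.
apply: (map_poly_inj (real_complex R)).
rewrite rmorph_prod [LHS]map_char_poly.
rewrite LE char_poly_similar ?unitarymx_unit // char_poly_trig.
  by apply: eq_bigr => i _; rewrite rmorphB /= map_polyX map_polyC /=
     [in LHS]DE !mxE eqxx.
exact: diag_mx_is_trig.
Qed.

(** The defining set of [spectrum] is inhabited, by the sorted list of
    the eigenvalues of a diagonalization. *)
Lemma spectrumP (R : realType) (N : nat) (L : 'M[R]_N) : L^T = L ->
  sorted <=%R (spectrum L) /\ char_poly L = \prod_(x <- spectrum L) ('X - x%:P).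
Proof.
move=> /symmetric_spectral[P [e [_ _ charL]]].
have : [set s : seq R | sorted <=%R s /\
    char_poly L = \prod_(x <- s) ('X - x%:P)]%classic (spectrum L).
  apply: xgetPex; exists (sort <=%R [seq e 0 i | i : 'I_N]); split.
    exact: sort_sorted le_total _.
  rewrite charL (perm_big [seq e 0 i | i : 'I_N]) ?perm_sort //=.
  by rewrite big_image.
by [].
Qed.

(** With more coordinates in [T] than equations in [A], a homogeneous system
    restricted to [T] has a nonzero solution. *)
Lemma ker_supported (F : fieldType) (N k : nat) (T : {set 'I_N}) (A : 'M[F]_(N, k)) :
  (k < #|T|)%N ->
  exists2 w : 'rV_N, w != 0 & w *m A = 0 /\ forall i, i \notin T -> w 0 i = 0.
Proof.
move=> ltkT; pose f : 'I_#|T| -> 'I_N := enum_val.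
have /rowV0Pn[w /sub_kermxP wB w0] : kermx (rowsub f A) != 0.
  rewrite -mxrank_eq0 mxrank_ker -lt0n subn_gt0.
  exact: leq_ltn_trans (rank_leq_col _) ltkT.
have wfE i : (w *m rowsub f 1%:M) 0 i = \sum_s w 0 s *+ (f s == i).
  by rewrite mxE; apply: eq_bigr => s _; rewrite !mxE mulr_natr.
exists (w *m rowsub f 1%:M).
  apply: contra w0 => /eqP wf0; apply/eqP/rowP => s.
  move/rowP/(_ (f s)): wf0; rewrite wfE (bigD1 s) //= eqxx big1 ?addr0 ?mxE //.
  by move=> t /negPf nts; rewrite (inj_eq enum_val_inj) nts.
split; first by rewrite -mulmxA mul_rowsub_mx mul1mx.
move=> i iT; rewrite wfE big1 // => s _; case: eqP => // fsi.
by rewrite -fsi enum_valP in iT.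
Qed.

Lemma mulmx_trC_re_im (R : rcfType) (N : nat) (v : 'rV[R[i]]_N) :
  (v *m v ^t*) 0 0 = (\sum_j map_mx (@complex.Re R) v 0 j ^+ 2 +
                     \sum_j map_mx (@complex.Im R) v 0 j ^+ 2)%:C%C.
Proof.
rewrite mxE -big_split rmorph_sum /=; apply: eq_bigr => j _.
by rewrite !mxE add_Re2_Im2 -normCK.
Qed.

Lemma re_mulmx_real (R : rcfType) (N q : nat) (v : 'rV[R[i]]_N) (M : 'M[R]_(N, q)) :
  map_mx (@complex.Re R) (v *m toC M) = map_mx (@complex.Re R) v *m M /\
  map_mx (@complex.Im R) (v *m toC M) = map_mx (@complex.Im R) v *m M.
Proof.
split; apply/rowP => j; rewrite !mxE raddf_sum; apply: eq_bigr => i _; rewrite !mxE;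
case: (v 0 i) => a b /=; ring.
Qed.

(** The half of the Courant-Fischer principle that bounds eigenvalues below.
    If [k.+1] eigenvalues were smaller than [lam], the span of their
    eigenvectors would meet the kernel of [C] in a nonzero vector, at which
    the form of [M *m M^T] is smaller than [lam] times the squared norm. *)
Lemma kth_eigenvalue_ge (R : realType) (N k q : nat) (M : 'M[R]_(N, q))
    (C : 'M[R]_(N, k)) (lam : R) : (k < N)%N ->
    (forall x : 'rV_N, x *m C = 0 ->
       lam * \sum_i x 0 i ^+ 2 <= \sum_j (x *m M) 0 j ^+ 2) ->
  lam <= kth_eigenvalue k.+1 (M *m M^T).
Proof.
move=> ltkN Hlam; rewrite /kth_eigenvalue /=.
have symL : (M *m M^T)^T = M *m M^T by rewrite trmx_mul trmxK.
have [sorted_s char_s] := spectrumP symL.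
have [P [e [PP LE charE]]] := symmetric_spectral symL.
set s := spectrum _ in sorted_s char_s *.
rewrite leNgt; apply/negP => s_lt.
have perm_s : perm_eq s [seq e 0 i | i : 'I_N].
  by apply: prod_XsubC_eq; rewrite -char_s charE big_image.
have size_s : size s = N by rewrite (perm_size perm_s) size_map -cardE card_ord.
pose T := [set i | e 0 i < lam].
(* The spectrum is sorted, so its first [k.+1] terms are below [lam]. *)
have ltkT : (k < #|T|)%N.
  have -> : #|T| = count (< lam) s.
    rewrite (permP perm_s) count_map cardE size_filter -enumT.
    by apply: eq_count => i /=; rewrite inE.
  rewrite -[s](cat_take_drop k.+1) count_cat; apply: leq_trans (leq_addr _ _).
  have -> : count (< lam) (take k.+1 s) = size (take k.+1 s).
    apply/eqP; rewrite -all_count; apply/(all_nthP 0) => i.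
    rewrite size_takel ?size_s // => ltik; rewrite nth_take //.
    apply: le_lt_trans s_lt; apply: (sorted_leq_nth le_trans le_refl) => //.
    - by rewrite inE size_s (leq_ltn_trans _ ltkN).
    - by rewrite inE size_s.
  by rewrite size_takel // size_s.
have [w w0 [wC wT]] := ker_supported (P *m toC C) ltkT.
pose v := w *m P.
have [Re_C Im_C] := re_mulmx_real v C.
have [Re_M Im_M] := re_mulmx_real v M.
have vC : v *m toC C = 0 by rewrite /v -mulmxA.
rewrite vC in Re_C Im_C.
have real_le : lam * (\sum_i map_mx (@complex.Re R) v 0 i ^+ 2 +
                      \sum_i map_mx (@complex.Im R) v 0 i ^+ 2) <=
    \sum_j map_mx (@complex.Re R) (v *m toC M) 0 j ^+ 2 +
    \sum_j map_mx (@complex.Im R) (v *m toC M) 0 j ^+ 2.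
  rewrite mulrDr Re_M Im_M; apply: lerD; apply: Hlam.
    by rewrite -Re_C; apply/rowP => i; rewrite !mxE.
  by rewrite -Im_C; apply/rowP => i; rewrite !mxE.
have : lam%:C%C * (v *m v ^t*) 0 0 <= ((v *m toC M) *m (v *m toC M) ^t*) 0 0.
  by rewrite !mulmx_trC_re_im -rmorphM lecR.
have -> : v *m v ^t* = w *m w ^t*.
  by rewrite /v trmx_mul map_mxM !mulmxA -(mulmxA w) PP mulmx1.
have -> : v *m toC M *m (v *m toC M) ^t* = w *m diag_mx (toC e) *m w ^t*.
  have -> : (v *m toC M) ^t* = (toC M)^T *m v ^t*.
    rewrite trmx_mul map_mxM; congr (_ *m _); apply/matrixP => i j.
    by rewrite !mxE; apply/eqP; rewrite eq_complex /= oppr0 !eqxx.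
  rewrite (map_trmx _ M) mulmxA -(mulmxA v) -map_mxM LE /v trmx_mul map_mxM !mulmxA.
  by rewrite -(mulmxA w) PP mulmx1 -!mulmxA (mulmxA P) PP mul1mx.
rewrite lt_geF // mul_mx_diag !mxE mulr_sumr.
have /rV0Pn[i0 wi0] := w0.
have wD i : (\matrix_(i, j) (w i j * (toC e) 0 j)) 0 i * (w ^t*) i 0 =
    (e 0 i)%:C%C * `|w 0 i| ^+ 2.
  by rewrite !mxE mulrAC -normCK mulrC.
rewrite (bigD1 i0) //= [ltRHS](bigD1 i0) //= wD; apply: ltr_leD.
  rewrite !mxE -normCK ltr_pM2r ?exprn_gt0 ?normr_gt0 // ltcR.
  by apply: contraNT wi0 => e_i0; rewrite wT // inE.
apply: ler_sum => i _; rewrite wD !mxE -normCK.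
have [iT|/wT->] := boolP (i \in T); last by rewrite normr0 expr0n !mulr0.
by rewrite ler_wpM2r ?exprn_ge0 // lecR ltW //; rewrite inE in iT.
Qed.

(** The bound is uniform in [M], so the set whose supremum defines the
    algebraic connectivity is bounded. *)
Lemma kth_eigenvalue_le (R : realType) (N k q : nat) (M : 'M[R]_(N, q)) (B : R) :
    (forall i j, `|M i j| <= B) ->
  kth_eigenvalue k (M *m M^T) <= (q * N)%:R * B ^+ 2.
Proof.
move=> MB; rewrite /kth_eigenvalue.
have symL : (M *m M^T)^T = M *m M^T by rewrite trmx_mul trmxK.
have [_ char_s] := spectrumP symL; set s := spectrum _ in char_s *.
have [ltk|lek] := ltnP k.-1 (size s); last first.
  by rewrite nth_default // mulr_ge0 ?sqr_ge0.
set e := nth _ _ _; have : e \in s by exact: mem_nth.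
rewrite -root_prod_XsubC -char_s -eigenvalue_root_char => /eigenvalueP[x xL x0].
have sqr_gt0 : 0 < \sum_i x 0 i ^+ 2.
  have /rV0Pn[i xi0] := x0; rewrite (bigD1 i) //= ltr_pwDl ?exprn_even_gt0 //.
  by apply: sumr_ge0 => j _; exact: sqr_ge0.
rewrite -(ler_pM2r sqr_gt0); apply: le_trans (sum_sqr_mulmx_le x MB).
have dotE p (y : 'rV[R]_p) : \sum_i y 0 i ^+ 2 = (y *m y^T) 0 0.
  by rewrite mxE; apply: eq_bigr => i _; rewrite !mxE.
by rewrite !dotE trmx_mul !mulmxA -(mulmxA x) xL -scalemxAl [leRHS]mxE.
Qed.

Local Close Scope sesquilinear_scope.

(** * The stiffness form of a complete bipartite graph *)

Lemma directionC (R : realType) (d : nat) (V : finType) (p : V -> 'rV[R]_d) u v :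
  direction p v u = - direction p u v.
Proof.
rewrite /direction eq_sym; case: eqP => _; first by rewrite oppr0.
rewrite -opprB scalerN; congr (- (_^-1 *: _)).
congr Num.sqrt; apply: eq_bigr => i _.
by rewrite -opprB !mxE sqrrN.
Qed.

Lemma direction_abs_le1 (R : realType) (d : nat) (V : finType)
    (p : V -> 'rV[R]_d) u v i : `|direction p u v 0 i| <= 1.
Proof.
rewrite /direction; case: eqP => [_|_]; first by rewrite mxE normr0.
set w := p u - p v; rewrite mxE normrM normfV.
have le_norm : `|w 0 i| <= `|euclidean_norm w|.
  rewrite -sqrtr_sqr [leRHS]ger0_norm ?sqrtr_ge0 // /euclidean_norm.
  rewrite ler_wsqrtr // (bigD1 i) //= lerDl.
  by apply: sumr_ge0 => j _; exact: sqr_ge0.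
have [->|n0] := eqVneq `|euclidean_norm w| 0; first by rewrite invr0 mul0r.
by rewrite mulrC ler_pdivrMr ?mul1r // lt0r n0 normr_ge0.
Qed.

Lemma pick_other_end (V : finType) (u v : V) : u != v ->
  [pick w | [set u; v] == [set u; w]] = Some v.
Proof.
move=> uv; case: pickP => [w /eqP/setP uvw|/(_ v)]; last by rewrite eqxx.
have := uvw v; rewrite !inE eqxx orbT eq_sym (negPf uv) /= => /esym/eqP vw.
by rewrite vw.
Qed.

Lemma pick_no_end (V : finType) (u v u' : V) : u' != u -> u' != v ->
  [pick w | [set u; v] == [set u'; w]] = None.
Proof.
move=> uu' vu'; case: pickP => // w /eqP/setP/(_ u').
by rewrite !inE eqxx (negPf uu') (negPf vu').
Qed.

Lemma mulmx_rigidity (R : realType) (d : nat) (V : finType) (G : sgraph V)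
    (p : V -> 'rV[R]_d) (x : 'rV[R]_#|{: V * 'I_d}|) c u v :
    u != v -> enum_val c = [set u; v] ->
  (x *m rigidity_mx G p) 0 c =
  \sum_t direction p u v 0 t *
    (x 0 (enum_rank (u, t)) - x 0 (enum_rank (v, t))).
Proof.
move=> uv cE; rewrite mxE (reindex _ (onW_bij _ (enum_rank_bij _))) /=.
transitivity (\sum_w \sum_t
    x 0 (enum_rank (w, t)) * rigidity_mx G p (enum_rank (w, t)) c).
  by rewrite pair_big; apply: eq_bigr => -[].
have rigE w t : rigidity_mx G p (enum_rank (w, t)) c =
    if [pick z | [set u; v] == [set w; z]] is Some z then direction p w z 0 t else 0.
  by rewrite mxE enum_rankK cE.
rewrite (bigD1 u) //= (bigD1 v) /=; last by rewrite eq_sym.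
rewrite [X in _ + (_ + X)]big1 => [|w /andP[wu wv]].
  rewrite addr0 -big_split; apply: eq_bigr => t _ /=.
  rewrite !rigE pick_other_end // finset.setUC pick_other_end 1?eq_sym //.
  by rewrite (directionC p u v) mxE; ring.
by rewrite big1 // => t _; rewrite rigE pick_no_end // mulr0.
Qed.

(** The squared entries of [x *m rigidity_mx] are the terms of the
    stiffness form, one for each edge. *)
Lemma sum_sqr_rigidity_bipartite (R : realType) (d n m : nat)
    (p : 'I_n + 'I_m -> 'rV[R]_d)
    (x : 'rV[R]_#|{: ('I_n + 'I_m) * 'I_d}|) :
  \sum_i \sum_j (\sum_t direction p (inl i) (inr j) 0 t *
     (x 0 (enum_rank (inl i, t)) - x 0 (enum_rank (inr j, t)))) ^+ 2 <=
  \sum_c (x *m rigidity_mx (complete_bipartite n m) p) 0 c ^+ 2.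
Proof.
pose f (ij : 'I_n * 'I_m) : {set 'I_n + 'I_m} := [set inl ij.1; inr ij.2].
have fE ij : f ij \in edges (complete_bipartite n m).
  by apply/imsetP; exists (inl ij.1, inr ij.2); rewrite ?inE.
pose h ij : 'I_#|edges (complete_bipartite n m)| := enum_rank_in (fE ij) (f ij).
have hE ij : enum_val (h ij) = f ij by rewrite enum_rankK_in.
have h_inj : injective h.
  move=> [i j] [i' j'] /(congr1 enum_val); rewrite !hE => /setP eq_f.
  have := eq_f (inl i); have := eq_f (inr j); rewrite !inE !eqxx /=.
  move=> /esym/eqP[->] /esym; rewrite orbF => /eqP[->] //.
rewrite pair_big /= (bigID (mem [set h ij | ij : 'I_n * 'I_m])) /=.
rewrite big_imset /=; last by move=> ? ? _ _; exact: h_inj.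
apply: ler_wpDr; first by apply: sumr_ge0 => ? _; exact: sqr_ge0.
by apply: ler_sum => ij _; rewrite (@mulmx_rigidity _ _ _ _ _ _ _ (inl ij.1) (inr ij.2)).
Qed.

Lemma stiffness_eigenvalue_ge (R : realType) (d n m : nat)
    (p : 'I_n + 'I_m -> 'rV[R]_d) (T : finType)
    (C : 'I_n + 'I_m -> 'I_d -> T -> R) (lam : R) :
    (#|T| < (n + m) * d)%N ->
    (forall x : 'I_n + 'I_m -> 'I_d -> R,
       (forall tau, \sum_v \sum_t x v t * C v t tau = 0) ->
       lam * \sum_v \sum_t x v t ^+ 2 <=
       \sum_i \sum_j (\sum_t direction p (inl i) (inr j) 0 t *
         (x (inl i) t - x (inr j) t)) ^+ 2) ->
  lam <= kth_eigenvalue #|T|.+1 (stiffness_mx (complete_bipartite n m) p).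
Proof.
move=> ltT Hlam.
pose CM : 'M[R]_(#|{: ('I_n + 'I_m) * 'I_d}|, #|T|) :=
  \matrix_(r, s) C (enum_val r).1 (enum_val r).2 (enum_val s).
apply: (@kth_eigenvalue_ge _ _ _ _ _ CM).
  by rewrite card_prod card_sum !card_ord.
move=> x xC; apply: le_trans (sum_sqr_rigidity_bipartite _ _).
have sumE (F : _ -> _ -> R) :
    \sum_(r < #|{: ('I_n + 'I_m) * 'I_d}|) F (enum_val r).1 (enum_val r).2 =
    \sum_(v : 'I_n + 'I_m) \sum_(t : 'I_d) F v t.
  rewrite pair_big /= (reindex _ (onW_bij _ (enum_rank_bij _))) /=.
  by apply: eq_bigr => vt _; rewrite enum_rankK.
pose y v t := x 0 (enum_rank (v, t)).
have xE r : x 0 r = y (enum_val r).1 (enum_val r).2.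
  by rewrite /y -surjective_pairing enum_valK.
under eq_bigr do rewrite xE.
rewrite (sumE (fun v t => y v t ^+ 2)); apply: (Hlam y) => tau.
move/rowP/(_ (enum_rank tau)): xC; rewrite !mxE => xC_tau; rewrite -[RHS]xC_tau.
rewrite -[LHS](sumE (fun v t => y v t * C v t tau)).
by apply: eq_bigr => r _; rewrite mxE enum_rankK xE.
Qed.

Lemma algebraic_connectivity_ge (R : realType) (d : nat) (V : finType)
    (G : sgraph V) (p : V -> 'rV[R]_d) (lam : R) :
    lam <= kth_eigenvalue ('C(d.+1, 2)).+1 (stiffness_mx G p) ->
  lam <= algebraic_connectivity R d G.
Proof.
move=> lam_le; apply: le_trans lam_le _; apply: sup_upper_bound; last by exists p.
split; first by exists (kth_eigenvalue ('C(d.+1, 2)).+1 (stiffness_mx G p)); exists p.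
exists ((#|edges G| * #|{: V * 'I_d}|)%:R * 1 ^+ 2) => _ [q _ <-].
apply: kth_eigenvalue_le => r c; rewrite mxE.
case: (enum_val r) => u i; case: pickP => [v _|_]; first exact: direction_abs_le1.
by rewrite normr0.
Qed.

(** * Points on a monomial curve *)

(** The relations extend by linearity from the powers of [x] to all
    polynomials of size at most [N]; the one that vanishes at every node but
    [x s] isolates the coefficient [c s]. *)
Lemma power_sums_eq0 (F : idomainType) (S : finType) (A : {set S})
    (x c : S -> F) (j0 N : nat) :
    {in A &, injective x} -> (forall s, x s != 0) -> (#|A| <= N)%N ->
    (forall j, (j < N)%N -> \sum_(s in A) c s * x s ^+ (j0 + j) = 0) ->
  forall s, s \in A -> c s = 0.
Proof.
move=> x_inj x0 leAN sum0 s sA.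
have sum_poly0 (P : {poly F}) : (size P <= N)%N ->
    \sum_(s in A) c s * x s ^+ j0 * P.[x s] = 0.
  move=> leP; under eq_bigr do rewrite (horner_coef_wide _ leP) mulr_sumr.
  rewrite exchange_big big1 // => j _ /=.
  transitivity (P`_j * \sum_(s in A) c s * x s ^+ (j0 + j)); last first.
    by rewrite sum0 ?mulr0.
  rewrite mulr_sumr; apply: eq_bigr => s' _.
  by rewrite exprD; ring.
pose P := \prod_(y <- [seq x s' | s' <- enum (A :\ s)]) ('X - y%:P).
have := sum_poly0 P; rewrite size_prod_XsubC size_map -cardE.
rewrite (cardsD1 s A) sA in leAN => /(_ leAN).
rewrite (bigD1 s) //= big1 => [|s' /andP[s'A s's]]; last first.
  rewrite [P.[_]](_ : _ = 0) ?mulr0 //; apply/rootP.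
  by rewrite root_prod_XsubC; apply/map_f; rewrite mem_enum !inE s's.
rewrite addr0 => /eqP; rewrite !mulf_eq0 expf_eq0 (negPf (x0 s)) andbF orbF.
case/orP => [/eqP//|]; rewrite -rootE root_prod_XsubC => /mapP[s'].
rewrite mem_enum !inE => /andP[s's s'A] xs.
by rewrite (x_inj _ _ sA s'A xs) eqxx in s's.
Qed.

Lemma card_triangle (n m : nat) : (n <= m)%N ->
  #|[set kl : 'I_n * 'I_m | (kl.2 <= kl.1)%N]| = 'C(n.+1, 2).
Proof.
move=> lenm; rewrite -sum1dep_card.
rewrite -(pair_big_dep xpredT (fun (k : 'I_n) (l : 'I_m) => (l <= k)%N)
  (fun _ _ => 1%N)) /=.
rewrite -bin2_sum big_mkord big_ord_recl add0n; apply: eq_bigr => k _.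
transitivity (\sum_(l < k.+1) 1)%N; last by rewrite sum1_card card_ord.
by rewrite (big_ord_widen m (fun=> 1%N)) //; exact: leq_trans (ltn_ord k) lenm.
Qed.

(** The sum determines the larger exponent, because it lies between
    [3 ^ k] and [2 * 3 ^ k], which is less than [3 ^ k.+1]. *)
Lemma sum_pow3_inj k l k' l' : (l <= k)%N -> (l' <= k')%N ->
  (3 ^ k + 3 ^ l = 3 ^ k' + 3 ^ l')%N -> k = k' /\ l = l'.
Proof.
have key i j i' j' : (j <= i)%N -> (j' <= i')%N ->
    (3 ^ i + 3 ^ j = 3 ^ i' + 3 ^ j')%N -> ~ (i < i')%N.
  move=> ji _ E lt_ii'.
  have := leq_pexp2l (isT : 0 < 3)%N ji; have := leq_pexp2l (isT : 0 < 3)%N lt_ii'.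
  have : (0 < 3 ^ i)%N by rewrite expn_gt0.
  by rewrite expnS; lia.
move=> lk l'k' E; have kk' : k = k'.
  have := key _ _ _ _ lk l'k' E; have := key _ _ _ _ l'k' lk (esym E); lia.
split=> //; rewrite kk' in E; move/eqP: E.
by rewrite eqn_add2l eqn_exp2l // => /eqP.
Qed.

(** The exponents form a Sidon sequence, so that products of two nodes are
    distinct; the shift by one makes [node 0 = 1], the homogenizing
    coordinate. *)
Definition node (R : pzRingType) (k : nat) : R := 2 ^+ (3 ^ k - 1).

Lemma node_gt0 (R : numDomainType) k : 0 < node R k.
Proof. by rewrite exprn_gt0. Qed.

Lemma node_neq0 (R : numDomainType) k : node R k != 0.
Proof. by rewrite gt_eqF ?node_gt0. Qed.

Lemma node_mul_inj (R : numDomainType) k l k' l' : (l <= k)%N -> (l' <= k')%N ->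
  node R k * node R l = node R k' * node R l' -> k = k' /\ l = l'.
Proof.
move=> lk l'k'; rewrite -!exprD => /ieexprIn E; apply: sum_pow3_inj => //.
have := E _ _; rewrite ltr0n pnatr_eq1 => /(_ isT isT).
have pos i : (0 < 3 ^ i)%N by rewrite expn_gt0.
have := pos k; have := pos l; have := pos k'; have := pos l'; lia.
Qed.

Lemma node_inj (R : numDomainType) : injective (node R).
Proof.
move=> k k' E; have [|||//] := @node_mul_inj R k k k' k'; rewrite ?leqnn ?E //.
Qed.

Lemma vandermonde_left_inverse (R : numFieldType) (d j0 N : nat) : (d <= N)%N ->
  exists B : 'M[R]_(d, N),
    B *m (\matrix_(i < N, k < d) node R k ^+ (j0 + i)) = 1%:M.
Proof.
move=> ledN; set A := \matrix_(i, k) _.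
suff /row_fullP : row_full A by [].
rewrite /row_full -mxrank_tr -[_ == _]/(row_free A^T) -kermx_eq0.
apply: contraT => /rowV0Pn[c /sub_kermxP cA0 /negP[]]; apply/eqP/rowP => k.
rewrite mxE; apply: (@power_sums_eq0 _ _ [set: 'I_d]
  (fun k : 'I_d => node R k) (fun k => c 0 k) j0 N) => //.
- by move=> ? ? _ _ /node_inj/val_inj.
- by move=> s; exact: node_neq0.
- by rewrite cardsT card_ord.
move=> j ltjN; move/rowP/(_ (Ordinal ltjN)): cA0; rewrite !mxE => cA0.
by rewrite -[RHS]cA0; apply: eq_big => s; rewrite ?inE // !mxE.
Qed.

(** Collecting symmetric pairs, the values of the quadratic form at the
    points of the curve are power sums in the nodes [node k * node l] with
    [l <= k], of which there are ['C(d.+1, 2)]. *)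
Lemma quadratic_form_skew (R : numFieldType) (d N : nat) (M : 'M[R]_d) :
    ('C(d.+1, 2) <= N)%N ->
    (forall j, (j < N)%N ->
       \sum_(k < d) \sum_(l < d) node R k ^+ j * M k l * node R l ^+ j = 0) ->
  forall k l, M k l = - M l k.
Proof.
move=> leN quad0.
pose A := [set kl : 'I_d * 'I_d | (kl.2 <= kl.1)%N].
pose x (kl : 'I_d * 'I_d) := node R kl.1 * node R kl.2.
pose c (kl : 'I_d * 'I_d) :=
  M kl.1 kl.2 + (if kl.1 == kl.2 then 0 else M kl.2 kl.1).
have c0 kl : kl \in A -> c kl = 0.
  apply: (@power_sums_eq0 _ _ A x c 0 N).
  - move=> [k l] [k' l']; rewrite !inE /x /= => lk l'k' E.
    by have [/val_inj-> /val_inj->] := node_mul_inj lk l'k' E.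
  - by move=> s; rewrite mulf_neq0 ?node_neq0.
  - by rewrite card_triangle.
  move=> j ltjN; rewrite -[RHS](quad0 _ ltjN) add0n.
  rewrite (pair_big xpredT xpredT (fun k l : 'I_d =>
    node R k ^+ j * M k l * node R l ^+ j)) /=.
  rewrite [RHS](bigID (mem A)) /=.
  under eq_bigr do rewrite mulrDl.
  rewrite big_split; congr (_ + _).
    by apply: eq_bigr => s _; rewrite /x exprMn; ring.
  have swapK : involutive (fun kl : 'I_d * 'I_d => (kl.2, kl.1)) by case.
  rewrite [RHS](reindex_inj (inv_inj swapK)) /=.
  rewrite [LHS]big_mkcond [RHS]big_mkcond; apply: eq_bigr => -[k l] _.
  rewrite /= !inE /= -ltnNge ltn_neqAle eq_sym -(inj_eq val_inj) /x /=.
  case: eqP => _; case: ifP => _ //=; rewrite ?mul0r // exprMn; ring.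
move=> k l.
wlog lk : k l / (l <= k)%N.
  move=> H; have [/H//|/ltnW/H->] := leqP l k; by rewrite opprK.
have := c0 (k, l); rewrite inE lk /c /= => /(_ isT).
case: eqP => [->|_]; first by rewrite addr0 => ->; rewrite oppr0.
by move/eqP; rewrite addr_eq0 => /eqP.
Qed.

(** * Infinitesimal rigidity of complete bipartite graphs *)

(** The rows are the vectors [p i] in homogeneous coordinates, the extra
    coordinate [c i] coming first. *)
Definition augment (R : pzRingType) (n d : nat) (c : 'I_n -> R)
    (p : 'I_n -> 'rV[R]_d) : 'M[R]_(n, d.+1) :=
  \matrix_(i, k) if unlift ord0 k is Some t then p i 0 t else c i.

Lemma augment_mul_tr (R : pzRingType) (n n' d : nat) (c : 'I_n -> R)
    (c' : 'I_n' -> R) (p : 'I_n -> 'rV[R]_d) (p' : 'I_n' -> 'rV[R]_d) i j :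
  (augment c p *m (augment c' p')^T) i j =
  c i * c' j + \sum_t p i 0 t * p' j 0 t.
Proof.
rewrite mxE big_ord_recl !mxE unlift_none; congr (_ + _).
by apply: eq_bigr => t _; rewrite !mxE liftK.
Qed.

(** The theorem of Bolker and Roth.  The left inverses [Bq] and [Br] say
    that the points of each side affinely span, and the third hypothesis that
    no quadric contains them all.  The last hypothesis normalizes the flex:
    the sums are the entries below the diagonal of the matrix that
    parametrizes it.  They lie in rows of positive index [lift ord0 t], which
    makes them linear in the coordinates of [w] alone. *)
Lemma bipartite_infinitesimal_rigidity (R : numFieldType) (d a b : nat)
    (q z : 'I_a -> 'rV[R]_d) (r w : 'I_b -> 'rV[R]_d)
    (Bq : 'M_(d.+1, a)) (Br : 'M_(d.+1, b))
    (Q := augment (fun=> 1) q) (S := augment (fun=> 1) r) :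
    Bq *m Q = 1%:M -> Br *m S = 1%:M ->
    (forall M, (forall i, (Q *m M *m Q^T) i i = 0) ->
               (forall j, (S *m M *m S^T) j j = 0) ->
       forall k l, M k l = - M l k) ->
    (forall i j, \sum_t (q i - r j) 0 t * (z i - w j) 0 t = 0) ->
    (forall (t : 'I_d) (l : 'I_d.+1), (l <= t)%N -> \sum_j Br l j * w j 0 t = 0) ->
  (forall i, z i = 0) /\ (forall j, w j = 0).
Proof.
move=> BQ BS skewP flex pin.
pose Z := augment (fun i => - \sum_t q i 0 t * z i 0 t) z.
pose W := augment (fun j => - \sum_t r j 0 t * w j 0 t) w.
have QZ i : (Q *m Z^T) i i = 0 by rewrite augment_mul_tr mul1r addNr.
have SW j : (S *m W^T) j j = 0 by rewrite augment_mul_tr mul1r addNr.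
have QWZS : Q *m W^T = - (Z *m S^T).
  apply/matrixP => i j; rewrite [in RHS]mxE !augment_mul_tr mul1r mulr1.
  have := flex i j; rewrite [LHS](_ : _ =
      \sum_t r j 0 t * w j 0 t - \sum_t q i 0 t * w j 0 t +
      (\sum_t q i 0 t * z i 0 t - \sum_t z i 0 t * r j 0 t)).
    set s1 := \sum_t r j 0 t * _; set s2 := \sum_t q i 0 t * w _ _ _.
    set s3 := \sum_t q i 0 t * _; set s4 := \sum_t z i 0 t * _ => E.
    by apply/eqP; rewrite -subr_eq0 -oppr_eq0 -[X in _ == X]E; apply/eqP; ring.
  rewrite -!sumrB -big_split; apply: eq_bigr => t _; rewrite !mxE /=; ring.
pose M := (Br *m W)^T.
have BS' : S^T *m Br^T = 1%:M by rewrite -trmx_mul BS trmx1.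
have ZE : Z = - (Q *m M).
  rewrite /M trmx_mul mulmxA QWZS mulNmx opprK -mulmxA BS' mulmx1 //.
have WE : W^T = M *m S^T.
  rewrite -[LHS]mul1mx -BQ -mulmxA QWZS ZE mulNmx opprK.
  by rewrite -!mulmxA (mulmxA Bq) BQ mul1mx.
have skewM : forall k l, M k l = - M l k.
  apply: skewP => [i|j].
    have := QZ i; rewrite ZE linearN /= mulmxN mxE => /eqP.
    have trE (A : 'M[R]_a) k : A k k = A^T k k by rewrite mxE.
    by rewrite oppr_eq0 => /eqP <-; rewrite trE trmx_mul trmxK.
  by have := SW j; rewrite WE mulmxA.
have M_low (t : 'I_d) (l : 'I_d.+1) : (l <= t)%N -> M (lift ord0 t) l = 0.
  move=> /pin <-; rewrite !mxE; apply: eq_bigr => j _.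
  by rewrite [W _ _]mxE liftK.
have M_lt (k l : 'I_d.+1) : (l < k)%N -> M k l = 0.
  move=> ltlk; case: (unliftP ord0 k) ltlk => [t ->|->] //.
  by rewrite lift0 ltnS; exact: M_low.
have M0 : M = 0.
  apply/matrixP => k l; rewrite [RHS]mxE.
  have [/M_lt M0|/M_lt//|/val_inj ->] := ltngtP k l.
    by rewrite skewM M0 oppr0.
  by apply/eqP; rewrite -[_ == _](mulrn_eq0 _ 2) mulr2n {1}skewM addNr.
split=> [i|j]; apply/rowP => t; rewrite [RHS]mxE.
  have -> : z i 0 t = Z i (lift ord0 t) by rewrite mxE liftK.
  by rewrite ZE M0 mulmx0 oppr0 mxE.
have -> : w j 0 t = W^T (lift ord0 t) j by rewrite !mxE liftK.
by rewrite WE M0 mul0mx mxE.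
Qed.

(** * Coercivity and the choice of a placement *)

(** The least of finitely many positive constants is positive. *)
Lemma uniform_positive (R : realDomainType) (I : finType) (P : I -> R -> Prop) :
    (forall i, exists2 c, 0 < c & P i c) ->
    (forall i c c', c' <= c -> P i c -> P i c') ->
  exists2 c, 0 < c & forall i, P i c.
Proof.
move=> Pex Pdown; pose c i := sval (cid2 (Pex i)).
exists (\big[Num.min/1]_i c i).
  by apply: lt_bigmin => [|i _]; rewrite ?ltr01 // /c; case: cid2.
move=> i; apply: (Pdown i (c i)); first exact: bigmin_le_cond.
by rewrite /c; case: cid2.
Qed.

(** An injective linear map has a left inverse, whose entries bound the
    norm of [z] by that of its image. *)
Lemma injective_coercive (R : realFieldType) (I J : finType) (T : I -> J -> R) :
    (forall z : I -> R, (forall j, \sum_i z i * T i j = 0) -> forall i, z i = 0) ->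
  exists2 mu, 0 < mu & forall z : I -> R,
    mu * \sum_i z i ^+ 2 <= \sum_j (\sum_i z i * T i j) ^+ 2.
Proof.
move=> T_inj; pose A := \matrix_(i < #|I|, j < #|J|) T (enum_val i) (enum_val j).
have sumE (K : finType) (F : K -> R) : \sum_(k < #|K|) F (enum_val k) = \sum_k F k.
  by rewrite [RHS](reindex _ (onW_bij _ (enum_val_bij _))).
have mulA (z : I -> R) j :
    ((\row_i z (enum_val i)) *m A) 0 j = \sum_i z i * T i (enum_val j).
  by rewrite mxE -[RHS]sumE; apply: eq_bigr => i _; rewrite !mxE.
have /row_freeP[B AB] : row_free A.
  rewrite -kermx_eq0; apply: contraT => /rowV0Pn[w /sub_kermxP wA0 /negP[]].
  pose z i := w 0 (enum_rank i).
  have wE : w = \row_i z (enum_val i) by apply/rowP=> i; rewrite mxE /z enum_valK.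
  apply/eqP/rowP => i; rewrite wE !mxE; apply: T_inj => j.
  by move/rowP/(_ (enum_rank j)): wA0; rewrite wE mulA enum_rankK mxE.
pose bnd := \sum_i \sum_j `|B i j|.
have B_le i j : `|B i j| <= bnd.
  rewrite /bnd (bigD1 i) //= (bigD1 j) //= -addrA lerDl addr_ge0 ?sumr_ge0 //.
  by move=> i' _; rewrite sumr_ge0.
pose K := (#|I| * #|J|)%:R * bnd ^+ 2.
have K0 : 0 <= K by rewrite mulr_ge0 ?sqr_ge0.
exists (K + 1)^-1 => [|z]; first by rewrite invr_gt0 ltr_wpDl.
rewrite mulrC ler_pdivrMr ?ltr_wpDl //.
pose w := \row_(i < #|I|) z (enum_val i).
have -> : \sum_i z i ^+ 2 = \sum_i (w *m A *m B) 0 i ^+ 2.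
  by rewrite -mulmxA AB mulmx1 -sumE; apply: eq_bigr => i _; rewrite mxE.
apply: le_trans (sum_sqr_mulmx_le (w *m A) B_le) _.
have -> : \sum_j (w *m A) 0 j ^+ 2 = \sum_j (\sum_i z i * T i j) ^+ 2.
  by rewrite -[RHS]sumE; apply: eq_bigr => j _; rewrite mulA.
rewrite mulrC ler_wpM2l ?lerDl //.
by apply: sumr_ge0 => j _; exact: sqr_ge0.
Qed.

Lemma direction_dot_eq0 (R : realType) (d : nat) (V : finType)
    (p : V -> 'rV[R]_d) u v (y : 'I_d -> R) : p u != p v ->
    \sum_t direction p u v 0 t * y t = 0 -> \sum_t (p u - p v) 0 t * y t = 0.
Proof.
move=> puv; rewrite /direction (negPf puv); set w := p u - p v.
have norm0 : (euclidean_norm w)^-1 != 0.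
  rewrite invr_eq0 gt_eqF // sqrtr_gt0.
  have /rV0Pn[t wt0] : w != 0 by rewrite subr_eq0.
  rewrite (bigD1 t) //= ltr_pwDl ?exprn_even_gt0 //.
  by apply: sumr_ge0 => s _; exact: sqr_ge0.
under eq_bigr do rewrite mxE -mulrA.
by rewrite -mulr_sumr => /eqP; rewrite mulf_eq0 (negPf norm0) => /eqP.
Qed.

(** The left inverse [B] recovers the coefficients [(c, y)] of an affine
    function from its values at the points. *)
Lemma augment_span (R : nzRingType) (d b : nat) (r : 'I_b -> 'rV[R]_d)
    (B : 'M_(d.+1, b)) (c : R) (y : 'I_d -> R) :
    B *m augment (fun=> 1) r = 1%:M ->
    (forall j, c + \sum_t r j 0 t * y t = 0) ->
  forall t, y t = 0.
Proof.
move=> BS span t; pose Y := augment (fun _ : 'I_1 => c) (fun=> \row_t y t).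
have SY : augment (fun=> 1) r *m Y^T = 0.
  apply/matrixP => j k; rewrite augment_mul_tr mul1r [RHS]mxE -[RHS](span j).
  by congr (_ + _); apply: eq_bigr => s _; rewrite mxE.
have : Y^T (lift ord0 t) ord0 = 0.
  by rewrite -[Y^T]mul1mx -BS -mulmxA SY mulmx0 mxE.
by rewrite !mxE liftK mxE.
Qed.

(** The homogeneous coordinate, for the node of index 0, is left out. *)
Definition curve_point (R : pzRingType) (d j : nat) : 'rV[R]_d :=
  \row_t node R t.+1 ^+ j.

Lemma augment_curve (R : pzRingType) (d n j0 : nat) :
  augment (fun=> 1) (fun i : 'I_n => curve_point R d (j0 + i)) =
  \matrix_(i < n, k < d.+1) node R k ^+ (j0 + i).
Proof.
apply/matrixP => i k; rewrite !mxE; case: (unliftP ord0 k) => [t ->|->].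
  by rewrite mxE lift0.
by rewrite /node expn0 subnn expr0 expr1n.
Qed.

Lemma curve_point_inj (R : numDomainType) (d : nat) : (0 < d)%N ->
  injective (curve_point R d).
Proof.
move=> d_gt0 i j /rowP/(_ (Ordinal d_gt0)); rewrite !mxE /= => /ieexprIn.
apply; first exact: node_gt0.
by rewrite /node gt_eqF // exprn_egt1 // ltr1n.
Qed.

(** One side takes the first [a] points of the curve, the other the next
    [b].  The two conditions on a single vertex say that its edges span the
    space. *)
Lemma rigid_placement (R : realType) (d a b : nat) : (0 < d)%N ->
    (d < a)%N -> (d < b)%N -> ('C(d.+2, 2) <= a + b)%N ->
  exists (p : 'I_a + 'I_b -> 'rV[R]_d) (B : 'M[R]_(d.+1, b)),
    [/\ forall i j, p (inl i) != p (inr j),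
        forall i (y : 'I_d -> R),
          (forall j, \sum_t (p (inl i) - p (inr j)) 0 t * y t = 0) ->
          forall t, y t = 0,
        forall j (y : 'I_d -> R),
          (forall i, \sum_t (p (inl i) - p (inr j)) 0 t * y t = 0) ->
          forall t, y t = 0 &
        forall x : 'I_a + 'I_b -> 'I_d -> R,
          (forall i j, \sum_t (p (inl i) - p (inr j)) 0 t *
             (x (inl i) t - x (inr j) t) = 0) ->
          (forall (t : 'I_d) (l : 'I_d.+1), (l <= t)%N ->
             \sum_j B l j * x (inr j) t = 0) ->
          forall v t, x v t = 0].
Proof.
move=> d_gt0 ltda ltdb leab.
pose q (i : 'I_a) := curve_point R d (0 + i).
pose r (j : 'I_b) := curve_point R d (a + j).
have [Bq] := vandermonde_left_inverse R 0 ltda; rewrite -augment_curve => BQ.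
have [Br] := vandermonde_left_inverse R a ltdb; rewrite -augment_curve => BS.
exists (fun v => match v with inl i => q i | inr j => r j end), Br; split.
- move=> i j; apply: contraTneq (ltn_ord i) => /(curve_point_inj d_gt0) E.
  by rewrite add0n in E; rewrite -leqNgt E leq_addr.
- move=> i y qry; apply: (augment_span (c := - \sum_t q i 0 t * y t) BS) => j.
  apply: oppr_inj; rewrite opprD opprK oppr0 -sumrB -[RHS](qry j).
  by apply: eq_bigr => t _; rewrite !mxE; ring.
- move=> j y qry; apply: (augment_span (c := - \sum_t r j 0 t * y t) BQ) => i.
  rewrite -[RHS](qry i) [LHS]addrC -sumrB.
  by apply: eq_bigr => t _; rewrite !mxE; ring.
move=> x flex pin.
have [|||z0 w0] := bipartite_infinitesimal_rigidity
  (z := fun i => \row_t x (inl i) t) (w := fun j => \row_t x (inr j) t) BQ BS.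
- rewrite !augment_curve => M Q0 S0; apply: (quadratic_form_skew leab) => j ltj.
  have quadE (n j0 : nat) (i : 'I_n)
      (A := \matrix_(i < n, k < d.+1) node R k ^+ (j0 + i)) :
    (A *m M *m A^T) i i =
      \sum_(k < d.+1) \sum_(l < d.+1) node R k ^+ (j0 + i) * M k l * node R l ^+ (j0 + i).
    rewrite mxE exchange_big; apply: eq_bigr => l _; rewrite !mxE mulr_suml.
    by apply: eq_bigr => k _; rewrite !mxE.
  have [ltja|leaj] := ltnP j a.
    by have := Q0 (Ordinal ltja); rewrite quadE.
  have ltjb : (j - a < b)%N by rewrite ltn_subLR.
  by have := S0 (Ordinal ltjb); rewrite quadE /= subnKC.
- move=> i j; rewrite -[RHS](flex i j); apply: eq_bigr => t _.
  by rewrite !mxE.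
- move=> t l lelt; rewrite -[RHS](pin t l lelt).
  by apply: eq_bigr => j _; rewrite mxE.
move=> [i|j] t.
  by move/rowP/(_ t): (z0 i); rewrite !mxE.
by move/rowP/(_ t): (w0 j); rewrite !mxE.
Qed.

(** Quantitative form of the preceding lemma, for unit directions in place
    of differences of points. *)
Lemma coercive_placement (R : realType) (d a b : nat) : (0 < d)%N ->
    (d < a)%N -> (d < b)%N -> ('C(d.+2, 2) <= a + b)%N ->
  exists (p : 'I_a + 'I_b -> 'rV[R]_d) (B : 'M[R]_(d.+1, b)) (mu : R),
    [/\ 0 < mu,
        forall i (y : 'I_d -> R), mu * \sum_t y t ^+ 2 <=
          \sum_j (\sum_t direction p (inl i) (inr j) 0 t * y t) ^+ 2,
        forall j (y : 'I_d -> R), mu * \sum_t y t ^+ 2 <=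
          \sum_i (\sum_t direction p (inl i) (inr j) 0 t * y t) ^+ 2 &
        forall x : 'I_a + 'I_b -> 'I_d -> R,
          (forall (t : 'I_d) (l : 'I_d.+1), (l <= t)%N ->
             \sum_j B l j * x (inr j) t = 0) ->
          mu * (\sum_v \sum_t x v t ^+ 2) <=
          \sum_i \sum_j (\sum_t direction p (inl i) (inr j) 0 t *
             (x (inl i) t - x (inr j) t)) ^+ 2].
Proof.
move=> d_gt0 ltda ltdb leab.
have [p [B [p_neq span_l span_r rigid]]] := rigid_placement R d_gt0 ltda ltdb leab.
pose D i j t := direction p (inl i) (inr j) 0 t.
have down (I : finType) (y : I -> R) (S c c' : R) : c' <= c ->
    c * \sum_t y t ^+ 2 <= S -> c' * \sum_t y t ^+ 2 <= S.
  move=> le_c; apply: le_trans; rewrite ler_wpM2r //.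
  by apply: sumr_ge0 => t _; exact: sqr_ge0.
have [mu1 mu1_gt0 coer1] : exists2 mu, 0 < mu & forall i (y : 'I_d -> R),
    mu * \sum_t y t ^+ 2 <= \sum_j (\sum_t D i j t * y t) ^+ 2.
  apply: uniform_positive => [i|i c c' le_c H y]; last exact: down le_c (H y).
  have [|mu mu_gt0 H] := @injective_coercive R _ _ (fun t j => D i j t).
    move=> y Dy; apply: (span_l i) => j; apply: direction_dot_eq0 => //.
    by rewrite -[RHS](Dy j); apply: eq_bigr => t _; rewrite mulrC.
  exists mu => // y; apply: le_trans (H y) _; apply: ler_sum => j _.
  by under eq_bigr do rewrite mulrC.
have [mu2 mu2_gt0 coer2] : exists2 mu, 0 < mu & forall j (y : 'I_d -> R),
    mu * \sum_t y t ^+ 2 <= \sum_i (\sum_t D i j t * y t) ^+ 2.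
  apply: uniform_positive => [j|j c c' le_c H y]; last exact: down le_c (H y).
  have [|mu mu_gt0 H] := @injective_coercive R _ _ (fun t i => D i j t).
    move=> y Dy; apply: (span_r j) => i; apply: direction_dot_eq0 => //.
    by rewrite -[RHS](Dy i); apply: eq_bigr => t _; rewrite mulrC.
  exists mu => // y; apply: le_trans (H y) _; apply: ler_sum => i _.
  by under eq_bigr do rewrite mulrC.
have [mu3 mu3_gt0 coer3] : exists2 mu, 0 < mu & forall x : 'I_a + 'I_b -> 'I_d -> R,
    (forall (t : 'I_d) (l : 'I_d.+1), (l <= t)%N ->
       \sum_j B l j * x (inr j) t = 0) ->
    mu * (\sum_v \sum_t x v t ^+ 2) <=
    \sum_i \sum_j (\sum_t D i j t * (x (inl i) t - x (inr j) t)) ^+ 2.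
  (* One linear map collects the elongations of the edges and the
     normalizing conditions; a positive constant for it also serves when the
     latter vanish. *)
  pose T (vt : ('I_a + 'I_b) * 'I_d) (c : 'I_a * 'I_b + 'I_d * 'I_d.+1) : R :=
    match c, vt.1 with
    | inl (i, j), inl i' => (i' == i)%:R * D i j vt.2
    | inl (i, j), inr j' => - ((j' == j)%:R * D i j vt.2)
    | inr _, inl _ => 0
    | inr (t, l), inr j => ((l <= t)%N && (vt.2 == t))%:R * B l j
    end.
  have pick1 (n : nat) (i : 'I_n) (F : 'I_n -> R) : \sum_i' (i' == i)%:R * F i' = F i.
    rewrite (bigD1 i) //= eqxx mul1r big1 ?addr0 // => i' /negPf->.
    by rewrite mul0r.
  have sumT (z : ('I_a + 'I_b) * 'I_d -> R) c : \sum_vt z vt * T vt c =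
      \sum_i \sum_t z (inl i, t) * T (inl i, t) c +
      \sum_j \sum_t z (inr j, t) * T (inr j, t) c.
    transitivity (\sum_v \sum_t z (v, t) * T (v, t) c).
      by rewrite pair_big; apply: eq_bigr => -[].
    by rewrite big_sumType.
  have sumT_edge z i j : \sum_vt z vt * T vt (inl (i, j)) =
      \sum_t D i j t * (z (inl i, t) - z (inr j, t)).
    rewrite sumT.
    transitivity (
      \sum_i' (i' == i)%:R * (\sum_t D i j t * z (inl i', t)) +
      \sum_j' (j' == j)%:R * - (\sum_t D i j t * z (inr j', t))).
      congr (_ + _); apply: eq_bigr => k _; rewrite -?sumrN mulr_sumr;
      by apply: eq_bigr => t _; rewrite /T /=; ring.
    by rewrite !pick1 -sumrB; apply: eq_bigr => t _; ring.
  have sumT_pin z t l : \sum_vt z vt * T vt (inr (t, l)) =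
      (l <= t)%N%:R * \sum_j B l j * z (inr j, t).
    rewrite sumT big1 ?add0r => [|i _]; last by rewrite big1 // => s _; rewrite mulr0.
    rewrite mulr_sumr; apply: eq_bigr => j _.
    rewrite -(pick1 _ t (fun s => (l <= t)%N%:R * (B l j * z (inr j, s)))).
    by apply: eq_bigr => s _; rewrite /T /= -mulnb natrM; ring.
  have [|mu mu_gt0 H] := @injective_coercive R _ _ T.
    move=> z zT [v t]; apply: (rigid (fun v t => z (v, t))) => [i j|t' l lelt].
      apply: direction_dot_eq0 => //.
      by rewrite -[RHS](zT (inl (i, j))) sumT_edge.
    by have := zT (inr (t', l)); rewrite sumT_pin lelt mul1r.
  exists mu => // x pin; rewrite !pair_big /=.
  apply: le_trans (H (fun vt => x vt.1 vt.2)) _.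
  rewrite big_sumType /= [X in _ + X]big1 ?addr0 => [|[t l] _].
    by apply: ler_sum => -[i j] _; rewrite sumT_edge.
  rewrite sumT_pin; case: leqP => [/pin->|_]; rewrite ?mulr0 ?mul0r expr0n //.
exists p, B, (Num.min mu1 (Num.min mu2 mu3)); split.
- by rewrite !lt_min mu1_gt0 mu2_gt0.
- by move=> i y; apply: down (coer1 i y); rewrite ge_min lexx.
- by move=> j y; apply: down (coer2 j y); rewrite !ge_min lexx orbT.
- move=> x pin; rewrite pair_big /=.
  apply: (@down _ _ _ mu3); first by rewrite !ge_min lexx !orbT.
  by have := coer3 x pin; rewrite !pair_big.
Qed.

(** * Blowing up a placement *)

Definition mean (R : fieldType) (I : finType) (P : {set I}) (s : I -> R) : R :=
  (\sum_(u in P) s u) / #|P|%:R.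

Lemma mean_dot (R : fieldType) (I : finType) (P : {set I}) (d : nat)
    (c : 'I_d -> R) (x : I -> 'I_d -> R) :
  mean P (fun u => \sum_t c t * x u t) = \sum_t c t * mean P (x^~ t).
Proof.
rewrite /mean exchange_big mulr_suml; apply: eq_bigr => t _.
by rewrite mulrA mulr_sumr.
Qed.

Lemma sum_sub_mean (R : numFieldType) (I : finType) (P : {set I}) (s : I -> R) :
  (0 < #|P|)%N -> \sum_(u in P) (s u - mean P s) = 0.
Proof.
move=> P_gt0; rewrite sumrB sumr_const -mulr_natl /mean mulrC divfK ?subrr //.
by rewrite pnatr_eq0 -lt0n.
Qed.

Lemma sum_sqr_mean (R : numFieldType) (I : finType) (P : {set I}) (s : I -> R) :
    (0 < #|P|)%N ->
  \sum_(u in P) s u ^+ 2 =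
  \sum_(u in P) (s u - mean P s) ^+ 2 + #|P|%:R * mean P s ^+ 2.
Proof.
move=> P_gt0; have s0 := sum_sub_mean s P_gt0.
set S := mean P s in s0 *.
transitivity (\sum_(u in P) ((s u - S) ^+ 2 + S ^+ 2 + 2 * S * (s u - S))).
  by apply: eq_bigr => u _; ring.
rewrite 2!big_split /= -[X in _ + _ + X]mulr_sumr s0 mulr0 addr0.
by rewrite sumr_const mulr_natl.
Qed.

(** The cross terms vanish, since deviations from the mean sum to zero. *)
Lemma sum_sqr_sub_mean (R : numFieldType) (I J : finType) (P : {set I})
    (Q : {set J}) (s : I -> R) (t : J -> R) : (0 < #|P|)%N -> (0 < #|Q|)%N ->
  \sum_(u in P) \sum_(v in Q) (s u - t v) ^+ 2 =
    #|P|%:R * #|Q|%:R * (mean P s - mean Q t) ^+ 2 +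
    #|Q|%:R * \sum_(u in P) (s u - mean P s) ^+ 2 +
    #|P|%:R * \sum_(v in Q) (t v - mean Q t) ^+ 2.
Proof.
move=> P_gt0 Q_gt0; have t0 := sum_sub_mean t Q_gt0.
have inner u : \sum_(v in Q) (s u - t v) ^+ 2 =
    #|Q|%:R * (s u - mean Q t) ^+ 2 + \sum_(v in Q) (t v - mean Q t) ^+ 2.
  set T := mean Q t in t0 *.
  transitivity (\sum_(v in Q)
      ((s u - T) ^+ 2 + (t v - T) ^+ 2 - 2 * (s u - T) * (t v - T))).
    by apply: eq_bigr => v _; ring.
  rewrite sumrB big_split /= -[X in _ - X]mulr_sumr t0 mulr0 subr0.
  by rewrite sumr_const mulr_natl.
under eq_bigr do rewrite inner.
rewrite big_split /= sumr_const -[X in _ + X]mulr_natl -mulr_sumr.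
congr (_ + _); rewrite [#|P|%:R * _]mulrC -mulrA -mulrDr; congr (_ * _).
have := sum_sqr_mean (fun u => s u - mean Q t) P_gt0.
have -> : mean P (fun u => s u - mean Q t) = mean P s - mean Q t.
  rewrite /mean sumrB mulrBl sumr_const -[X in _ - X / _]mulr_natl.
  by rewrite mulrAC divff ?mul1r // pnatr_eq0 -lt0n.
move=> ->; rewrite addrC; congr (_ + _); apply: eq_bigr => u _.
by congr (_ ^+ 2); ring.
Qed.

Definition fiber (n a : nat) (pi : 'I_n -> 'I_a) (i : 'I_a) : {set 'I_n} :=
  [set u | pi u == i].

Lemma sum_fibers (R : nmodType) (n a : nat) (pi : 'I_n -> 'I_a) (F : 'I_n -> R) :
  \sum_u F u = \sum_i \sum_(u in fiber pi i) F u.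
Proof.
rewrite (partition_big pi xpredT) //=; apply: eq_bigr => i _.
by apply: eq_bigl => u; rewrite inE.
Qed.

(** The squared norm splits into deviations and means on each fiber, and
    a fiber has at most [n] elements. *)
Lemma sum_sqr_le_fibers (R : realFieldType) (n a d : nat) (pi : 'I_n -> 'I_a)
    (x : 'I_n -> 'I_d -> R) (X := fun i t => mean (fiber pi i) (x^~ t)) :
    (forall i, (0 < #|fiber pi i|)%N) ->
  \sum_u \sum_t x u t ^+ 2 <=
  \sum_i \sum_(u in fiber pi i) \sum_t (x u t - X i t) ^+ 2 +
    n%:R * \sum_i \sum_t X i t ^+ 2.
Proof.
move=> fib_gt0; rewrite (sum_fibers pi) mulr_sumr -big_split.
apply: ler_sum => i _ /=.
rewrite exchange_big [X in _ <= X + _]exchange_big mulr_sumr -big_split.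
apply: ler_sum => t _ /=; rewrite (sum_sqr_mean _ (fib_gt0 i)) lerD2l.
rewrite ler_wpM2r ?sqr_ge0 // ler_nat.
by rewrite -[leqRHS](card_ord n) max_card.
Qed.

(** The sum over pairs of vertices is grouped by pairs of fibers, where
    it splits into three terms.  The means are estimated by the rigidity of
    the small graph, the deviations by the spanning directions at one
    vertex. *)
Lemma blow_up_coercive (R : realFieldType) (d a b n m : nat)
    (D : 'I_a -> 'I_b -> 'I_d -> R) (mu nu eta : R)
    (pi : 'I_n -> 'I_a) (rho : 'I_m -> 'I_b)
    (x : 'I_n -> 'I_d -> R) (y : 'I_m -> 'I_d -> R)
    (X := fun i t => mean (fiber pi i) (x^~ t))
    (Y := fun j t => mean (fiber rho j) (y^~ t)) :
    0 < nu -> 0 < eta ->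
    (forall i, nu <= #|fiber pi i|%:R) -> (forall j, eta <= #|fiber rho j|%:R) ->
    (forall i (z : 'I_d -> R), mu * \sum_t z t ^+ 2 <=
       \sum_j (\sum_t D i j t * z t) ^+ 2) ->
    (forall j (z : 'I_d -> R), mu * \sum_t z t ^+ 2 <=
       \sum_i (\sum_t D i j t * z t) ^+ 2) ->
    mu * (\sum_i \sum_t X i t ^+ 2 + \sum_j \sum_t Y j t ^+ 2) <=
       \sum_i \sum_j (\sum_t D i j t * (X i t - Y j t)) ^+ 2 ->
  mu * (nu * eta * (\sum_i \sum_t X i t ^+ 2 + \sum_j \sum_t Y j t ^+ 2) +
    eta * (\sum_i \sum_(u in fiber pi i) \sum_t (x u t - X i t) ^+ 2) +
    nu * (\sum_j \sum_(v in fiber rho j) \sum_t (y v t - Y j t) ^+ 2)) <=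
  \sum_u \sum_v (\sum_t D (pi u) (rho v) t * (x u t - y v t)) ^+ 2.
Proof.
move=> nu_gt0 eta_gt0 nu_le eta_le coer_l coer_r coer.
have P_gt0 i : (0 < #|fiber pi i|)%N by rewrite -(ltr0n R) (lt_le_trans nu_gt0).
have Q_gt0 j : (0 < #|fiber rho j|)%N by rewrite -(ltr0n R) (lt_le_trans eta_gt0).
have -> : \sum_u \sum_v (\sum_t D (pi u) (rho v) t * (x u t - y v t)) ^+ 2 =
  \sum_i \sum_j \sum_(u in fiber pi i) \sum_(v in fiber rho j)
    ((\sum_t D i j t * x u t) - (\sum_t D i j t * y v t)) ^+ 2.
  rewrite (sum_fibers pi); apply: eq_bigr => i _.
  rewrite [RHS]exchange_big /=; apply: eq_bigr => u; rewrite inE => /eqP->.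
  rewrite (sum_fibers rho); apply: eq_bigr => j _.
  apply: eq_bigr => v; rewrite inE => /eqP->; congr (_ ^+ 2).
  by rewrite -sumrB; apply: eq_bigr => t _; rewrite mulrBr.
have cell i j : nu * eta * (\sum_t D i j t * (X i t - Y j t)) ^+ 2 +
    eta * (\sum_(u in fiber pi i) (\sum_t D i j t * (x u t - X i t)) ^+ 2) +
    nu * (\sum_(v in fiber rho j) (\sum_t D i j t * (y v t - Y j t)) ^+ 2) <=
    \sum_(u in fiber pi i) \sum_(v in fiber rho j)
    ((\sum_t D i j t * x u t) - (\sum_t D i j t * y v t)) ^+ 2.
  rewrite sum_sqr_sub_mean // !mean_dot.
  have dotB (z z' : 'I_d -> R) : \sum_t D i j t * (z t - z' t) =
      \sum_t D i j t * z t - \sum_t D i j t * z' t.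
    by rewrite -sumrB; apply: eq_bigr => t _; rewrite mulrBr.
  do 2?apply: lerD.
  - by rewrite dotB ler_wpM2r ?sqr_ge0 // ler_pM // ltW.
  - under eq_bigr do rewrite dotB.
    by rewrite ler_wpM2r // sumr_ge0 // => u _; exact: sqr_ge0.
  - under eq_bigr do rewrite dotB.
    by rewrite ler_wpM2r // sumr_ge0 // => v _; exact: sqr_ge0.
apply: le_trans (ler_sum _ (fun i _ => ler_sum _ (fun j _ => cell i j))).
under [X in _ <= X]eq_bigr do rewrite !big_split /=.
rewrite !big_split /= 2![mu * _]mulrDr; do 2?apply: lerD.
- rewrite mulrCA; under [X in _ <= X]eq_bigr do rewrite -mulr_sumr.
  by rewrite -mulr_sumr ler_wpM2l // mulr_ge0 ?ltW.
- rewrite mulrCA; under [X in _ <= X]eq_bigr do rewrite -mulr_sumr exchange_big /=.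
  rewrite -[X in _ <= X]mulr_sumr (ler_wpM2l (ltW eta_gt0)) // mulr_sumr.
  apply: ler_sum => i _; rewrite mulr_sumr; apply: ler_sum => u _; exact: coer_l.
- rewrite mulrCA [X in _ <= X]exchange_big /=.
  under [X in _ <= X]eq_bigr do rewrite -mulr_sumr exchange_big /=.
  rewrite -[X in _ <= X]mulr_sumr (ler_wpM2l (ltW nu_gt0)) // mulr_sumr.
  apply: ler_sum => j _; rewrite mulr_sumr; apply: ler_sum => v _; exact: coer_r.
Qed.

Definition mod_ord (a : nat) (a_gt0 : (0 < a)%N) (n : nat) (u : 'I_n) : 'I_a :=
  Ordinal (ltn_pmod u a_gt0).

Lemma fiber_mod_ord_ge (n a : nat) (a_gt0 : (0 < a)%N) (i : 'I_a) :
  (n %/ a <= #|fiber (@mod_ord a a_gt0 n) i|)%N.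
Proof.
have lt_si (s : 'I_(n %/ a)) : (s * a + i < n)%N.
  have : (s.+1 * a <= n)%N.
    by apply: leq_trans (leq_trunc_div n a); rewrite leq_mul2r ltn_ord orbT.
  by have := ltn_ord i; rewrite mulSn; lia.
pose f s : 'I_n := Ordinal (lt_si s).
have f_inj : injective f.
  move=> s s' [] /eqP; rewrite eqn_add2r eqn_pmul2r // => /eqP; exact: val_inj.
rewrite -[leqLHS]card_ord -(card_codom f_inj); apply/subset_leq_card/fintype.subsetP.
move=> u /codomP[s ->]; rewrite inE -val_eqE /= modnMDl.
by rewrite modn_small.
Qed.

Lemma half_ratio_le_divn (R : numFieldType) (n a : nat) : (0 < a <= n)%N ->
  n%:R / (2 * a%:R) <= (n %/ a)%:R :> R.
Proof.
move=> /andP[a_gt0 lean]; rewrite ler_pdivrMr ?mulr_gt0 ?ltr0n //.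
rewrite -!natrM ler_nat.
have := divn_eq n a; have := ltn_pmod n a_gt0.
have : (0 < n %/ a)%N by rewrite divn_gt0.
move: (n %/ a)%N (n %% a)%N => s r; nia.
Qed.

(** With [nu = n / (2 a)] and [eta = m / (2 b)] as lower bounds of the
    sizes of the fibers, the three coefficients [mu * nu * eta], [mu * eta]
    and [mu * nu] of the blown-up form are [c] times [n * m],
    [2 * a * m] and [2 * b * n], for [c = mu / (4 * a * b)]. *)
Lemma blow_up_connectivity (R : realType) (d a b : nat) : (0 < d)%N ->
    (d < a)%N -> (d < b)%N -> ('C(d.+2, 2) <= a + b)%N ->
  exists2 c : R, 0 < c & forall n m, (a <= n)%N -> (b <= m)%N ->
    c * (minn n m)%:R <= algebraic_connectivity R d (complete_bipartite n m).
Proof.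
move=> d_gt0 ltda ltdb leab.
have [p [B [mu [mu_gt0 coer_l coer_r coer]]]] :=
  coercive_placement R d_gt0 ltda ltdb leab.
have a_gt0 : (0 < a)%N by exact: leq_trans ltda.
have b_gt0 : (0 < b)%N by exact: leq_trans ltdb.
have aR : 0 < a%:R :> R by rewrite ltr0n.
have bR : 0 < b%:R :> R by rewrite ltr0n.
pose c : R := mu / (4 * a%:R * b%:R).
have c_gt0 : 0 < c by rewrite divr_gt0 // !mulr_gt0.
exists c => // n m lean lebm.
have n_gt0 : (0 < n)%N by exact: leq_trans lean.
have m_gt0 : (0 < m)%N by exact: leq_trans lebm.
pose pi := @mod_ord a a_gt0 n; pose rho := @mod_ord b b_gt0 m.
pose p' (v : 'I_n + 'I_m) : 'rV[R]_d :=
  match v with inl u => p (inl (pi u)) | inr v => p (inr (rho v)) end.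
apply: (@algebraic_connectivity_ge _ _ _ _ p').
pose A := [set tl : 'I_d * 'I_d.+1 | (tl.2 <= tl.1)%N].
have cardA : #|'I_#|A| | = 'C(d.+1, 2) by rewrite card_ord card_triangle.
(* The normalizing conditions on the mean velocities, pulled back to the
   vertices of the blown-up graph. *)
pose C (v : 'I_n + 'I_m) (t : 'I_d) (tau : 'I_#|A|) : R :=
  match v with
  | inl _ => 0
  | inr v => (t == (enum_val tau).1)%:R *
      (B (enum_val tau).2 (rho v) / #|fiber rho (rho v)|%:R)
  end.
rewrite -cardA; apply: (@stiffness_eigenvalue_ge _ _ _ _ _ _ C).
  rewrite cardA bin2 /=; apply: (@leq_ltn_trans (d.+1 * d)); first lia.
  by rewrite ltn_pmul2r //; lia.
move=> x xC.
pose X i t := mean (fiber pi i) (fun u => x (inl u) t).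
pose Y j t := mean (fiber rho j) (fun v => x (inr v) t).
pose nu : R := n%:R / (2 * a%:R); pose eta : R := m%:R / (2 * b%:R).
have nu_gt0 : 0 < nu by rewrite divr_gt0 ?mulr_gt0 ?ltr0n.
have eta_gt0 : 0 < eta by rewrite divr_gt0 ?mulr_gt0 ?ltr0n.
have nu_le i : nu <= #|fiber pi i|%:R.
  apply: le_trans (half_ratio_le_divn R _) _; first by rewrite a_gt0.
  by rewrite ler_nat fiber_mod_ord_ge.
have eta_le j : eta <= #|fiber rho j|%:R.
  apply: le_trans (half_ratio_le_divn R _) _; first by rewrite b_gt0.
  by rewrite ler_nat fiber_mod_ord_ge.
have P_gt0 i : (0 < #|fiber pi i|)%N by rewrite -(ltr0n R) (lt_le_trans nu_gt0).
have Q_gt0 j : (0 < #|fiber rho j|)%N by rewrite -(ltr0n R) (lt_le_trans eta_gt0).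
have pin (t : 'I_d) (l : 'I_d.+1) : (l <= t)%N -> \sum_j B l j * Y j t = 0.
  move=> lelt; have tlA : (t, l) \in A by rewrite inE.
  have := xC (enum_rank_in tlA (t, l)).
  rewrite big_sumType /= big1 ?add0r => [|u _]; last first.
    by rewrite big1 // => s _; rewrite mulr0.
  move=> E; rewrite -[RHS]E (sum_fibers rho); apply: eq_bigr => j _.
  rewrite /Y /mean mulrA mulrAC mulr_sumr; apply: eq_bigr => v.
  rewrite inE => /eqP rv; rewrite enum_rankK_in //= rv.
  rewrite (bigD1 t) //= eqxx big1 ?addr0 => [|s /negPf->]; last by rewrite !mul0r mulr0.
  by rewrite mul1r mulrC.
have coerXY : mu * (\sum_i \sum_t X i t ^+ 2 + \sum_j \sum_t Y j t ^+ 2) <=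
    \sum_i \sum_j (\sum_t direction p (inl i) (inr j) 0 t * (X i t - Y j t)) ^+ 2.
  have := coer (fun v => match v with inl i => X i | inr j => Y j end) pin.
  by rewrite big_sumType.
have := blow_up_coercive nu_gt0 eta_gt0 nu_le eta_le coer_l coer_r coerXY.
apply: le_trans.
have := sum_sqr_le_fibers (fun v => x (inr v)) Q_gt0.
have := sum_sqr_le_fibers (fun u => x (inl u)) P_gt0.
rewrite big_sumType /= -/X -/Y.
set sx := \sum_u \sum_t x (inl u) t ^+ 2; set sy := \sum_v \sum_t x (inr v) t ^+ 2.
set SX := \sum_i \sum_t X i t ^+ 2; set SY := \sum_j \sum_t Y j t ^+ 2.
set DX := \sum_i \sum_(u in _) _; set DY := \sum_j \sum_(v in _) _.
move=> sx_le sy_le.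
have SX_ge0 : 0 <= SX by do 2![apply: sumr_ge0 => ? _]; exact: sqr_ge0.
have SY_ge0 : 0 <= SY by do 2![apply: sumr_ge0 => ? _]; exact: sqr_ge0.
have DX_ge0 : 0 <= DX by do 3![apply: sumr_ge0 => ? _]; exact: sqr_ge0.
have DY_ge0 : 0 <= DY by do 3![apply: sumr_ge0 => ? _]; exact: sqr_ge0.
have -> : mu * (nu * eta * (SX + SY) + eta * DX + nu * DY) =
    c * (n%:R * m%:R * (SX + SY) + 2 * a%:R * m%:R * DX + 2 * b%:R * n%:R * DY).
  by rewrite /c /nu /eta; field; rewrite !gt_eqF.
rewrite -mulrA ler_pM2l //.
set k : R := (minn n m)%:R.
have kn : k <= n%:R by rewrite ler_nat geq_minl.
have km : k <= m%:R by rewrite ler_nat geq_minr.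
have k_ge0 : 0 <= k by rewrite ler0n.
apply: le_trans (_ : k * (DX + n%:R * SX + (DY + m%:R * SY)) <= _).
  by rewrite ler_wpM2l // lerD.
have a_ge1 : 1 <= a%:R :> R by rewrite ler1n.
have b_ge1 : 1 <= b%:R :> R by rewrite ler1n.
have -> : k * (DX + n%:R * SX + (DY + m%:R * SY)) =
  (n%:R * k * SX + m%:R * k * SY) + k * DX + k * DY by ring.
have -> : n%:R * m%:R * (SX + SY) = n%:R * m%:R * SX + m%:R * n%:R * SY by ring.
do 3?apply: lerD; apply: ler_wpM2r => //; try by apply: ler_wpM2l.
  apply: le_trans km _; rewrite ler_peMl ?ler0n //; lra.
apply: le_trans kn _; rewrite ler_peMl ?ler0n //; lra.
Qed.

Theorem theorem1p4 (R : realType) (d : nat) (d_ge1 : (1 <= d)%N) :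
  exists c : R, 0 < c /\
    forall n m : nat, (d.+1 <= n)%N -> (d.+1 <= m)%N ->
      ('C(d.+2, 2) <= n + m)%N ->
      c * (minn n m)%:R
        <= algebraic_connectivity R d (complete_bipartite n m).
Proof.
set N := 'C(d.+2, 2).
have ltdN : (d < N)%N by rewrite /N binS bin1 ltn_addl.
(* Sizes beyond [N] are truncated to [N], which leaves finitely many pairs. *)
pose P (ab : 'I_N.+1 * 'I_N.+1) (c : R) :=
  [&& d < ab.1, d < ab.2 & N <= ab.1 + ab.2]%N ->
  forall n m, (ab.1 <= n)%N -> (ab.2 <= m)%N ->
  c * (minn n m)%:R <= algebraic_connectivity R d (complete_bipartite n m).
have [||c c_gt0 cP] := @uniform_positive _ _ P.
- move=> ab; have [/and3P[lta ltb leab]|nab] :=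
    boolP [&& d < ab.1, d < ab.2 & N <= ab.1 + ab.2]%N.
    have [c c_gt0 H] := blow_up_connectivity R d_ge1 lta ltb leab.
    by exists c => // _; exact: H.
  by exists 1 => // H; rewrite H in nab.
- move=> ab c c' lec H ok n m len lem; apply: le_trans (H ok n m len lem).
  by rewrite ler_wpM2r.
exists c; split=> // n m ltdn ltdm leN.
have ltmin k : (minn k N < N.+1)%N by rewrite ltnS geq_minr.
apply: (cP (Ordinal (ltmin n), Ordinal (ltmin m))) => /=; rewrite ?geq_minl //.
by rewrite !leq_min ltdn ltdm ltdN /=; lia.
Qed.
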